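(* For every accuracy $\delta$ with $\frac{41}{43}<\delta\le 1$, there is no online algorithm for Online Bin Packing with Estimated Item Sizes with accuracy $\delta$ that is $c$-competitive for some $c<\frac{3}{2}$.
   Context: Online Bin Packing with Estimated Item Sizes: an input is a list $L=a_1,\dots,a_n$ of items. Before any item is revealed, the algorithm receives the accuracy $\delta\in(0,1]$ and an estimated size $c'(a)\in(0,1]$ for every item $a\in L$. The items are then revealed one by one together with their actual sizes $c(a)$, where $c(a)\in[c'(a)(1-\delta),\min(c'(a)(1+\delta),1)]$; each item must be irrevocably assigned to a bin of capacity $1$ (total size of items in a bin at most $1$) before the next item is revealed. The goal is to minimize the number of bins used. $A(L)$ denotes the number of bins used by algorithm $A$ on $L$ and $OPT(L)$ the minimum number of bins in any packing of $L$. An algorithm $A$ is $c$-competitive if there is a constant $K$ such that $A(L)\le c\cdot OPT(L)+K$ for every input list $L$. *)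

(* Defs.v *)
From HB Require Import structures.
From mathcomp Require Import all_boot all_order all_algebra.
From mathcomp Require Import reals.
Set Implicit Arguments.
Unset Strict Implicit.
Unset Printing Implicit Defensive.
Import Order.TTheory GRing.Theory Num.Theory.
Local Open Scope ring_scope.

(* Items are indexed by ['I_n] in order of arrival.  A packing labels every
   item with its bin; the bins in use are the labels that occur, so [p j]
   ranges over all of them in [is_packing]. *)
Definition is_packing (R : realType) (T : eqType) (n : nat)
    (c : n.-tuple R) (p : 'I_n -> T) : bool :=
  [forall j : 'I_n, \sum_(i < n | p i == p j) tnth c i <= 1].

Definition nbins (T : eqType) (n : nat) (p : 'I_n -> T) : nat :=
  size (undup (codom p)).

(* Bin labels in ['I_n] suffice for [n] items ([opt_le], [opt_attained]); the
   default value [n] is reached by giving each item a bin of its own. *)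
Definition opt (R : realType) (n : nat) (c : n.-tuple R) : nat :=
  \big[minn/n]_(p : {ffun 'I_n -> 'I_n} | is_packing c p) nbins p.

Definition valid_input (R : realType) (delta : R) (n : nat)
    (e c : n.-tuple R) : Prop :=
  forall i : 'I_n,
    0 < tnth e i <= 1 /\
    tnth e i * (1 - delta) <= tnth c i
      <= Num.min (tnth e i * (1 + delta)) 1.

(* [A delta e s] is the bin chosen for the last item of [s], where [e] lists
   the estimated sizes of all the items of the input, in order of arrival, and
   [s] the actual sizes revealed so far, current item included.  The algorithm
   is deterministic, so its earlier decisions are functions of the same data.
   Any natural number may serve as a bin label. *)
Definition online_algorithm (R : realType) : Type :=
  R -> seq R -> seq R -> nat.

Definition run (R : realType) (A : online_algorithm R) (delta : R) (n : nat)
    (e c : n.-tuple R) : 'I_n -> nat :=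
  fun i => A delta e (take i.+1 c).

(* Sizes are nonnegative when [delta <= 1], so a bin that respects its capacity
   at the end of the run has respected it after every assignment. *)
Definition feasible (R : realType) (delta : R) (A : online_algorithm R) : Prop :=
  forall (n : nat) (e c : n.-tuple R),
    valid_input delta e c -> is_packing c (run A delta e c).

Definition competitive (R : realType) (delta : R) (A : online_algorithm R)
    (r : R) : Prop :=
  exists K : R, forall (n : nat) (e c : n.-tuple R),
    valid_input delta e c ->
    (nbins (run A delta e c))%:R <= r * (opt c)%:R + K.

Lemma opt_le (R : realType) (T : eqType) (n : nat) (c : n.-tuple R)
    (p : 'I_n -> T) : is_packing c p -> (opt c <= nbins p)%N.
Proof.
move=> /forallP pP.
have ltn i : (index (p i) (codom p) < n)%N.
  have := codom_f p i.
  by rewrite -index_mem size_codom card_ord.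
pose q := [ffun i : 'I_n => Ordinal (ltn i)].
have qE i j : (q i == q j) = (p i == p j).
  rewrite !ffunE -val_eqE /=; apply/eqP/eqP => [|-> //].
  by apply: (index_inj (p i)); exact: codom_f.
have qP : is_packing c q.
  by apply/forallP => j; rewrite (eq_bigl (fun i => p i == p j)).
apply: (@leq_trans (nbins q)).
  rewrite /opt -big_filter.
  have : q \in [seq f : {ffun 'I_n -> 'I_n} <- index_enum _ | is_packing c f].
    by rewrite mem_filter qP mem_index_enum.
  elim: [seq _ <- _ | _] => // f s IH; rewrite inE big_cons => /predU1P[<-|/IH].
    exact: geq_minl.
  by apply: leq_trans; exact: geq_minr.
rewrite /nbins -(size_map val).
rewrite -(size_map (fun y => index y (codom p)) (undup (codom p))).
apply: uniq_leq_size.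
  by rewrite map_inj_uniq ?undup_uniq //; exact: val_inj.
move=> k /mapP[j]; rewrite mem_undup => /codomP[i ->] ->.
by rewrite ffunE /=; apply/mapP; exists (p i) => //; rewrite mem_undup codom_f.
Qed.

Lemma opt_attained (R : realType) (n : nat) (c : n.-tuple R) :
  (forall i, tnth c i <= 1) ->
  exists2 p : 'I_n -> 'I_n, is_packing c p & nbins p = opt c.
Proof.
move=> c1; rewrite /opt.
apply: (big_ind (fun m => exists2 p : 'I_n -> 'I_n, is_packing c p &
                                                    nbins p = m)) => [|x y [p pP <-] [q qP <-]|p pP].
- exists id.
    by apply/forallP => j; rewrite big_pred1_eq.
  by rewrite /nbins undup_id ?size_codom ?card_ord //
    /codom /image_mem map_id enum_uniq.
- by case: (leqP (nbins p) (nbins q)) => _; [exists p | exists q].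
- by exists p.
Qed.

(* Main.v *)
Require Import Defs.
From HB Require Import structures.
From mathcomp Require Import all_boot all_order all_algebra.
From mathcomp Require Import reals.
From mathcomp Require Import zify ring lra.
Set Implicit Arguments.
Unset Strict Implicit.
Unset Printing Implicit Defensive.
Import Order.TTheory GRing.Theory Num.Theory.
Local Open Scope ring_scope.

(** The lower bound is Yao's: [6 m] items of size slightly above [1/7], then
    [6 m] slightly above [1/3], then [6 m] slightly above [1/2], all announced
    with the same estimate.  The adversary may stop after each of the three
    phases, but since the number of items is announced it must then fill up the
    input with items of the smallest admissible size.  The ratio between the
    largest and the smallest admissible size is [(1 + delta) / (1 - delta)],
    which exceeds [42] as soon as [delta > 41/43]; the filler is then smaller
    than [1/84] and fits into the space left over by the optimal packings,
    which use [m], [3 m] and [6 m] bins.  If [A0], [A1], [A2] are the numbers of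
    bins of the algorithm after the three phases, then weighting the items of
    the three phases by [1], [2], [2] gives [2 (A0 + A1 + A2) >= 30 m], which
    is [3] times the sum of the three optima. *)

Lemma sum_divn_modn (V : nmodType) (q k : nat) (F : nat -> nat -> V) :
  \sum_(i < q * k) F (i %/ k)%N (i %% k)%N = \sum_(a < q) \sum_(r < k) F a r.
Proof.
elim: q => [|q IH]; first by rewrite mul0n !big_ord0.
rewrite mulSnr big_split_ord big_ord_recr /= IH; congr (_ + _).
apply: eq_bigr => r _; have k_gt0 : (0 < k)%N by case: k r {IH} => // -[].
by rewrite divnMDl // divn_small // addn0 modnMDl modn_small.
Qed.

(** Put item [i] into bin [i %% k]: each bin gets exactly one item from each of the [q] blocks of
    [k] consecutive items. *)
Lemma opt_periodic (R : realType) (n q k : nat) (G : nat -> R)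
    (c : n.-tuple R) :
  (0 < k)%N -> n = (q * k)%N -> (forall i, tnth c i = G (i %/ k)%N) ->
  \sum_(a < q) G a <= 1 -> (opt c <= k)%N.
Proof.
move=> k_gt0 nE; subst n => cE G1.
apply: (@leq_trans (nbins (fun i : 'I_(q * k) => (i %% k)%N))).
  apply: opt_le; apply/forallP => j.
  rewrite big_mkcond; under eq_bigr do rewrite cE.
  rewrite (sum_divn_modn q k (fun a r => if r == (j %% k)%N then G a else 0)).
  rewrite (eq_bigr (fun a : 'I_q => G a)) // => a _.
  by rewrite -big_mkcond (big_pred1 (Ordinal (ltn_pmod j k_gt0))).
rewrite /nbins -[leqRHS](size_iota 0); apply: uniq_leq_size.
  exact: undup_uniq.
by move=> b; rewrite mem_undup mem_iota => /codomP[i ->]; rewrite ltn_pmod.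
Qed.

Lemma sum_fibers (V : nmodType) (T : eqType) (n : nat) (p : 'I_n -> T)
    (v : 'I_n -> V) :
  \sum_(b <- undup (codom p)) \sum_(i < n | p i == b) v i = \sum_(i < n) v i.
Proof.
rewrite (exchange_big_dep predT) //=; apply: eq_bigr => i _.
under eq_bigl => b do rewrite eq_sym.
rewrite -big_filter filter_pred1_uniq ?undup_uniq ?mem_undup ?codom_f //.
by rewrite big_seq1.
Qed.

(** Used with [p] the full run, [q] the run stopped after phase [t] and [D] the items of phases up
    to [t]: the bins that [D] opens in [p] occur in [q] too. *)
Lemma count_labels_le (T : eqType) (n : nat) (p q : 'I_n -> T)
    (D : pred 'I_n) :
  {in D, p =1 q} ->
  (\sum_(b <- undup (codom p)) [exists (i | D i), p i == b] <= nbins q)%N.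
Proof.
move=> pq; rewrite -big_mkcond sum1_count -size_filter.
apply: uniq_leq_size; first by rewrite filter_uniq ?undup_uniq.
move=> b; rewrite mem_filter => /andP[/existsP[i /andP[Di /eqP <-]] _].
by rewrite mem_undup pq // codom_f.
Qed.

(* The sizes [1/7], [1/3], [1/2] in units of [1/42]. *)
Definition phase_weight (j : nat) : nat := nth 0%N [:: 6; 14; 21] j.

Definition phase_value (j : nat) : nat := nth 0%N [:: 1; 2; 2] j.

(** The right side is 6, 4 or 2 when the earliest item of the bin is of phase 0, 1 or 2. Value is at
    most a sixth of weight, hence at most 6; without phase 0 at most two items fit, and from phase 2
    only one. *)
Lemma bin_value_le (T : eqType) (n : nat) (p : 'I_n -> T) (ph : 'I_n -> nat)
    (b : T) :
  (forall i, (ph i < 3)%N) ->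
  (\sum_(i < n | p i == b) phase_weight (ph i) < 42)%N ->
  (\sum_(i < n | p i == b) phase_value (ph i)
    <= 2 * \sum_(t < 3) [exists (i | (ph i <= t)%N), p i == b])%N.
Proof.
move=> ph3; pose x (j : nat) := (\sum_(i < n | p i == b) (ph i == j))%N.
have split_phase (w : nat -> nat) : (\sum_(i < n | p i == b) w (ph i) =
    w 0 * x 0 + w 1 * x 1 + w 2 * x 2)%N.
  rewrite /x !big_distrr -!big_split /=; apply: eq_bigr => i _.
  by case: (ph i) (ph3 i) => [|[|[|]]] //= _; lia.
pose E t := [exists (i | (ph i <= t)%N), p i == b].
have xP j t : (j <= t)%N -> (0 < x j)%N -> E t.
  move=> jt; rewrite lt0n => x0; apply: contraNT x0 => /existsPn h.
  apply/eqP; rewrite /x big1 // => i pib; apply/eqP; rewrite eqb0.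
  by apply/negP => /eqP phi; have := h i; rewrite phi jt pib.
rewrite (split_phase phase_weight) (split_phase phase_value).
rewrite !big_ord_recr big_ord0 /= -!/(E _).
have := xP 0%N 0%N isT; have := xP 0%N 1%N isT; have := xP 0%N 2%N isT.
have := xP 1%N 1%N isT; have := xP 1%N 2%N isT; have := xP 2%N 2%N isT.
rewrite /phase_weight /phase_value /=.
by case: (E 0%N); case: (E 1%N); case: (E 2%N); lia.
Qed.

Section Adversary.

Variables (R : realType) (delta : R).
Hypothesis hdelta : 41 / 43 < delta <= 1.

(** Positive exactly when [delta > 41/43]; the divisor keeps it at most 1/200 and leaves room for
    [filler_le]. *)
Definition excess : R := (43 * delta - 41) / 400.

Definition estimate : R := (1 / 2 + excess) / (1 + delta).

Definition filler : R := estimate * (1 - delta).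

Definition adversary_size (t j : nat) : R :=
  if (j <= t)%N then (phase_weight j)%:R / 42 + excess else filler.

Definition adversary_input (m t : nat) : (18 * m).-tuple R :=
  [tuple adversary_size t (i %/ (6 * m)) | i < 18 * m].

Definition adversary_estimates (m : nat) : (18 * m).-tuple R :=
  [tuple estimate | i < 18 * m].

Lemma excess_gt0 : 0 < excess.
Proof. by rewrite /excess; move: hdelta => /andP[]; lra. Qed.

Lemma estimate_max : estimate * (1 + delta) = 1 / 2 + excess.
Proof. by rewrite /estimate divfK //; move: hdelta => /andP[]; lra. Qed.

Lemma filler_ge0 : 0 <= filler.
Proof.
rewrite /filler mulr_ge0 ?divr_ge0 //; have := excess_gt0;
  move: hdelta => /andP[]; lra.
Qed.

(** The tightest case for the filler: when only phase 0 is played, a bin of the packing holds six of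
    its items and twelve fillers. *)
Lemma filler_le : 6 * excess + 12 * filler <= 1 / 7.
Proof.
have /andP[d0 d1] := hdelta.
have fE : filler * (1 + delta) = (1 / 2 + excess) * (1 - delta).
  by rewrite /filler mulrAC estimate_max.
rewrite -(@ler_pM2r _ (1 + delta)); last lra.
have -> : (6 * excess + 12 * filler) * (1 + delta) =
    6 * excess * (1 + delta) + 12 * (filler * (1 + delta)) by ring.
rewrite fE /excess; nra.
Qed.

Lemma phase_lt3 m (i : 'I_(18 * m)) : (i %/ (6 * m) < 3)%N.
Proof. by case: i => i /= hi; rewrite ltn_divLR; lia. Qed.

Lemma adversary_valid m t :
  valid_input delta (adversary_estimates m) (adversary_input m t).
Proof.
move=> i; rewrite !tnth_mktuple -/filler estimate_max.
have /andP[d0 d1] := hdelta.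
have e0 := excess_gt0; have f0 := filler_ge0; have f1 := filler_le.
have e1 : excess <= 1 / 200 by rewrite /excess; lra.
split.
  rewrite /estimate divr_gt0 /=; try lra.
  by rewrite ler_pdivrMr; lra.
rewrite le_min /adversary_size.
case: ifP => _; last by apply/and3P; split; lra.
by case: (i %/ _)%N (phase_lt3 i) => [|[|[|]]] //= _; apply/and3P; split; lra.
Qed.

Lemma opt_adversary m t : (0 < m)%N -> (t < 3)%N ->
  (opt (adversary_input m t) <= nth 0 [:: 1; 3; 6] t * m)%N.
Proof.
move=> m0 t3; pose d := nth 0%N [:: 1; 3; 6] t.
(* Each bin takes [q] items, [s] from each phase, where unplayed phases supply fillers. *)
pose q := nth 0%N [:: 18; 6; 3] t; pose s := nth 0%N [:: 6; 2; 1] t.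
apply: (@opt_periodic _ _ q _ (fun a => adversary_size t (a %/ s))).
- by case: t t3 {d q s} => [|[|[|]]] //= _; lia.
- by rewrite /q; case: t t3 {d q s} => [|[|[|]]] //= _; lia.
- move=> i; rewrite tnth_mktuple -divnMA; congr (adversary_size _ (_ %/ _)).
  by rewrite /s; case: t t3 {d q s} => [|[|[|]]] //= _; lia.
have e0 := excess_gt0; have f0 := filler_ge0; have f1 := filler_le.
have e1 : excess <= 1 / 200 by have /andP[_ d1] := hdelta; rewrite /excess; lra.
by rewrite /q /s; case: t t3 {d q s} => [|[|[|]]] //= _;
  rewrite !big_ord_recr big_ord0 /= /adversary_size /phase_weight /=; lra.
Qed.

(** The estimates are the same, and so are the sizes revealed up to item [i]. *)
Lemma run_adversary (A : online_algorithm R) m t (i : 'I_(18 * m)) :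
  (i %/ (6 * m) <= t)%N ->
  run A delta (adversary_estimates m) (adversary_input m 2) i =
  run A delta (adversary_estimates m) (adversary_input m t) i.
Proof.
move=> it; rewrite /run; congr (A _ _ _).
apply: (@eq_from_nth _ 0) => [|j]; first by rewrite !size_take !size_tuple.
rewrite size_take size_tuple => hj.
have ji : (j <= i)%N by have := ltn_ord i; move: hj; case: ifP; lia.
have jn : (j < 18 * m)%N by apply: leq_ltn_trans (ltn_ord i).
rewrite !nth_take //; pose j' := Ordinal jn.
rewrite -!(tnth_nth 0 _ j') !tnth_mktuple /adversary_size /=.
by rewrite -ltnS (phase_lt3 j') (leq_trans (leq_div2r _ ji)).
Qed.

Lemma bins_adversary (A : online_algorithm R) m : (0 < m)%N ->
  feasible delta A ->
  (30 * m <= 2 * \sum_(t < 3)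
    nbins (run A delta (adversary_estimates m) (adversary_input m t)))%N.
Proof.
move=> m0 /(_ _ _ _ (@adversary_valid m 2)).
set p := run _ _ _ _ => /forallP p_packing.
pose ph (i : 'I_(18 * m)) := (i %/ (6 * m))%N.
have -> : (30 * m = \sum_(i < 18 * m) phase_value (ph i))%N.
  rewrite /ph; have -> : (18 * m = 3 * (6 * m))%N by lia.
  rewrite (sum_divn_modn 3 (6 * m) (fun a _ => phase_value a)).
  under eq_bigr do rewrite sum_nat_const card_ord.
  by rewrite !big_ord_recr big_ord0 /phase_value /=; lia.
rewrite -(sum_fibers p).
apply: (@leq_trans (\sum_(b <- undup (codom p))
    2 * \sum_(t < 3) [exists (i | (ph i <= t)%N), p i == b])%N).
  rewrite [leqLHS]big_seq [leqRHS]big_seq; apply: leq_sum => b.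
  rewrite mem_undup => /codomP[j ->]; apply: bin_value_le.
    exact: phase_lt3.
  (* The bin contains [j], and each item exceeds its nominal size by [excess], so the nominal load
     is strictly below 1. *)
  have := p_packing j; rewrite -(ltr_nat R) natr_sum => sum_le1.
  suff : \sum_(i < 18 * m | p i == p j) (phase_weight (ph i))%:R / 42
      < \sum_(i < 18 * m | p i == p j) tnth (adversary_input m 2) i.
    rewrite -mulr_suml; lra.
  apply: ltr_sum => [|i _]; first by apply/hasP; exists j.
  rewrite tnth_mktuple /adversary_size -ltnS phase_lt3 ltrDl.
  exact: excess_gt0.
rewrite -big_distrr leq_mul2l exchange_big /=; apply: leq_sum => t _.
by apply: count_labels_le => i; exact: run_adversary.
Qed.

End Adversary.

Theorem theorem2 (R : realType) (delta : R) (hdelta : 41 / 43 < delta <= 1) :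
  ~ exists A : online_algorithm R,
      feasible delta A /\
      exists c : R, c < 3 / 2 /\ competitive delta A c.
Proof.
move=> [A [A_feasible [c [c_lt [K A_le]]]]].
(* A negative [c] is replaced by 0, so that upper bounds on [opt] can be multiplied by the ratio. *)
have [r [c_le r_ge0 r_lt]] : exists r : R, [/\ c <= r, 0 <= r & r < 3 / 2].
  by exists (Num.max c 0); rewrite !le_max !lexx orbT gt_max c_lt divr_gt0.
(* The three runs give [30 m <= 2 (1 + 3 + 6) r m + 6 K], which fails for large [m]. *)
pose m := (Num.bound `|6 * K / (30 - 20 * r)|).+1.
have m_gt : 6 * K < (30 - 20 * r) * m%:R.
  rewrite [ltRHS]mulrC -ltr_pdivrMr; last lra.
  apply: (le_lt_trans (ler_norm _)); apply: (lt_trans (archi_boundP _)) => //.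
  by rewrite ltr_nat ltnSn.
pose a t := nbins (run A delta (adversary_estimates delta m)
  (adversary_input delta m t)).
have aP t : (t < 3)%N ->
    (a t)%:R <= r * ((nth 0 [:: 1; 3; 6] t)%N%:R * m%:R) + K.
  move=> t3; apply: le_trans (A_le _ _ _ (@adversary_valid _ _ hdelta m t)) _.
  rewrite lerD2r -natrM; apply: (le_trans (ler_wpM2r (ler0n _ _) c_le)).
  by rewrite ler_wpM2l // ler_nat opt_adversary.
have := bins_adversary hdelta (isT : (0 < m)%N) A_feasible.
rewrite !big_ord_recr big_ord0 /= add0n -!/(a _).
rewrite -(ler_nat R) !natrM !natrD.
have := aP 0%N isT; have := aP 1%N isT; have := aP 2%N isT => /=.
lra.
Qed.
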